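(* Let $R$ be a reduced commutative ring with unity. If $f,g \in R[\![X]\!]$ satisfy $fg = 0$, then $c'(f)\, c'(g) = 0$, where $c'$ is the map from $R[\![X]\!]$ to the set of countably generated ideals of $R$ that sends a power series to the ideal generated by its coefficients. Hence $c'$ is an Armendariz map from $(R[\![X]\!],\cdot)$ to the semigroup of countably generated ideals of $R$ under ideal multiplication.
   Context: A semigroup with zero is a commutative (multiplicatively written) semigroup $S$ with an absorbing element $0$. It is nilpotent-free if $x^n = 0$ for some positive integer $n$ implies $x=0$. When $R$ is reduced, both $(R[\![X]\!],\cdot)$ and the set of countably generated ideals of $R$ under multiplication (with zero the zero ideal) are nilpotent-free semigroups. A set map $g: S \to T$ between nilpotent-free semigroups is an Armendariz map if (i) $g$ is surjective; (ii) for any $s\in S$, $s=0$ if and only if $g(s)=0$; (iii) for any $s,s'\in S$, $ss'=0$ if and only if $g(s)g(s')=0$. (It need not be a homomorphism.) *)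

(* Defs.v *)
From HB Require Import structures.
From mathcomp Require Import all_boot all_algebra.
From mathcomp Require Import boolp classical_sets functions cardinality.

Set Implicit Arguments.
Unset Strict Implicit.
Unset Printing Implicit Defensive.

Import GRing.Theory.
Local Open Scope classical_set_scope.
Local Open Scope ring_scope.

(* [comPzRingType] allows the zero ring, the only one in which the case [n = 0]
   of the hypothesis can occur. *)
Definition reduced (R : comPzRingType) : Prop :=
  forall (x : R) (n : nat), x ^+ n = 0 -> x = 0.

Record nfSemigroup := NFSemigroup {
  nfs_sort :> Type;
  nfs_mul : nfs_sort -> nfs_sort -> nfs_sort;
  nfs_zero : nfs_sort;
  nfs_mulA : associative nfs_mul;
  nfs_mulC : commutative nfs_mul;
  nfs_mul0 : left_zero nfs_zero nfs_mul;
  (* there is no unit: for [0 < n], [iterop n mul x x] is the n-th power of x *)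
  nfs_nilpotent_free : forall (x : nfs_sort) (n : nat),
    (0 < n)%N -> iterop n nfs_mul x x = nfs_zero -> x = nfs_zero }.

Definition Armendariz_map (S T : nfSemigroup) (g : S -> T) : Prop :=
  [/\ forall t : T, exists s : S, g s = t,
      forall s : S, s = nfs_zero S <-> g s = nfs_zero T
    & forall s s' : S,
        nfs_mul s s' = nfs_zero S <-> nfs_mul (g s) (g s') = nfs_zero T].

Lemma iterop_nilpotent_free (S : Type) (mul : S -> S -> S) (z : S) :
  associative mul -> commutative mul -> left_zero z mul ->
  (forall x, mul x x = z -> x = z) ->
  forall x n, (0 < n)%N -> iterop n mul x x = z -> x = z.
Proof.
move=> mA mC m0 sq x [//|n] _; elim: n => // n IHn.
rewrite iteropS iterS; set y := iter n (mul x) x => xy0.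
apply: IHn; rewrite iteropS -/y; apply: sq.
case: n @y xy0 => [|n] y xy0; first exact: xy0.
have -> : mul y y = mul (mul x y) (iter n (mul x) x).
  by rewrite {2}/y iterS mA [mul y x]mC.
by rewrite xy0 m0.
Qed.

(* A power series is its sequence of coefficients; the record keeps the Cauchy
   product apart from the pointwise ring structure on functions. *)
Record fps (R : comPzRingType) := FPS { fps_coef : nat -> R }.

Notation "{ 'fps' R }" := (fps R) (format "{ 'fps'  R }") : type_scope.

HB.instance Definition _ (R : comPzRingType) := gen_eqMixin {fps R}.
HB.instance Definition _ (R : comPzRingType) := gen_choiceMixin {fps R}.

Section PowerSeriesRing.
Variable R : comPzRingType.
Implicit Types f g h : {fps R}.

Definition fps_zero : {fps R} := FPS (fun=> 0).
Definition fps_one : {fps R} := FPS (fun n => (n == 0%N)%:R).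
Definition fps_opp f : {fps R} := FPS (fun n => - fps_coef f n).
Definition fps_add f g : {fps R} := FPS (fun n => fps_coef f n + fps_coef g n).
Definition fps_mul f g : {fps R} :=
  FPS (fun n => \sum_(i < n.+1) fps_coef f i * fps_coef g (n - i)).

Lemma fpsP f g : (forall n, fps_coef f n = fps_coef g n) -> f = g.
Proof. by case: f g => f [g] /= /funext ->. Qed.

Fact fps_addA : associative fps_add.
Proof. by move=> f g h; apply: fpsP => n /=; rewrite addrA. Qed.
Fact fps_addC : commutative fps_add.
Proof. by move=> f g; apply: fpsP => n /=; rewrite addrC. Qed.
Fact fps_add0 : left_id fps_zero fps_add.
Proof. by move=> f; apply: fpsP => n /=; rewrite add0r. Qed.
Fact fps_addN : left_inverse fps_zero fps_opp fps_add.
Proof. by move=> f; apply: fpsP => n /=; rewrite addNr. Qed.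

HB.instance Definition _ :=
  GRing.isZmodule.Build {fps R} fps_addA fps_addC fps_add0 fps_addN.

Fact fps_mulC : commutative fps_mul.
Proof.
move=> f g; apply: fpsP => n /=.
rewrite (reindex_inj rev_ord_inj) /=.
by apply: eq_bigr => j _; rewrite (sub_ordK j) mulrC.
Qed.

Fact fps_mulA : associative fps_mul.
Proof.
move=> f g h; rewrite [in RHS]fps_mulC [fps_mul g h]fps_mulC.
apply: fpsP => n /=.
pose c i j := fps_coef f i * (fps_coef g (n - i - j)%N * fps_coef h j).
transitivity (\sum_(i < n.+1) \sum_(j < n.+1 | (j <= n - i)%N) c i j).
  apply: eq_bigr => /= i _; rewrite big_distrr /=.
  rewrite (big_ord_narrow_leq (leq_subr _ _)) /=.
  by apply: eq_bigr => j _; rewrite /c; congr (_ * _); rewrite mulrC.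
rewrite (exchange_big_dep predT) //=; apply: eq_bigr => j _.
transitivity (\sum_(i < n.+1 | (i <= n - j)%N) c i j).
  apply: eq_bigl => i; rewrite -ltnS -(ltnS i) -!subSn ?leq_ord //.
  by rewrite -subn_gt0 -(subn_gt0 i) -!subnDA addnC.
rewrite (big_ord_narrow_leq (leq_subr _ _)) mulrC big_distrl /=.
by apply: eq_bigr => i _; rewrite /c -!subnDA addnC mulrA.
Qed.

Fact fps_mul1 : left_id fps_one fps_mul.
Proof.
move=> f; apply: fpsP => n /=; rewrite big_ord_recl subn0 mul1r.
by rewrite big1 ?addr0 // => i _; rewrite mul0r.
Qed.

Fact fps_mulDl : left_distributive fps_mul fps_add.
Proof.
move=> f g h; apply: fpsP => n /=; rewrite -big_split.
by apply: eq_bigr => i _; rewrite mulrDl.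
Qed.

HB.instance Definition _ := GRing.Zmodule_isComPzRing.Build {fps R}
  fps_mulA fps_mulC fps_mul1 fps_mulDl.

Lemma fps_sqr_eq0 : reduced R -> forall f, f * f = 0 -> f = 0.
Proof.
move=> hR f ff0; apply: fpsP => n /=.
elim/ltn_ind: n => n IHn; apply: (hR _ 2).
have := congr1 (fun h => fps_coef h (n + n)) ff0 => /=.
have ltn2 : (n < (n + n).+1)%N by rewrite ltnS leq_addr.
rewrite (bigD1 (Ordinal ltn2)) //= addnK big1 ?addr0 // => i.
rewrite -val_eqE /= neq_ltn => /orP[lt_in|lt_ni].
  by rewrite (IHn i) ?mul0r.
rewrite [X in _ * X]IHn ?mulr0 // ltn_subLR ?ltn_add2r //.
by rewrite -ltnS ltn_ord.
Qed.

End PowerSeriesRing.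

Definition fps_nfs (R : comPzRingType) (hR : reduced R) : nfSemigroup :=
  @NFSemigroup {fps R} *%R 0 (@mulrA _) (@mulrC _) (@mul0r _)
    (iterop_nilpotent_free (@mulrA _) (@mulrC _) (@mul0r _) (fps_sqr_eq0 hR)).

(* The ideals of [ring_quotient] are decidable and proper, hence too
   restrictive here. *)
Definition is_ideal (R : comPzRingType) (I : set R) : Prop :=
  [/\ I 0, forall x y, I x -> I y -> I (x + y) & forall a x, I x -> I (a * x)].

Definition ideal_gen (R : comPzRingType) (A : set R) : set R :=
  smallest (@is_ideal R) A.

(* [countable] includes finite sets, so finitely generated ideals qualify. *)
Record cgideal (R : comPzRingType) := CGIdeal {
  cgideal_set : set R;
  cgideal_countably_generated :
    exists2 A : set R, countable A & cgideal_set = ideal_gen A }.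

Definition set_mul (R : comPzRingType) (A B : set R) : set R :=
  [set z | exists x y, [/\ A x, B y & z = x * y]].

Definition ideal_mul (R : comPzRingType) (I J : set R) : set R :=
  ideal_gen (set_mul I J).

Section Ideals.
Variable R : comPzRingType.
Implicit Types A B C : set R.

Lemma cgideal_inj (I J : cgideal R) : cgideal_set I = cgideal_set J -> I = J.
Proof.
by case: I J => I hI [J hJ] /= eqIJ; subst J; congr CGIdeal; apply: Prop_irrelevance.
Qed.

Lemma ideal_gen_ideal A : is_ideal (ideal_gen A).
Proof.
split=> [I [[]]//|x y hx hy I hI|a x hx I hI]; case: (hI) => -[_ hD hM] _.
  by apply: hD; [apply: hx|apply: hy].
by apply: hM; apply: hx.
Qed.

Lemma ideal_genM A B : ideal_mul (ideal_gen A) (ideal_gen B) =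
  ideal_gen (set_mul A B).
Proof.
have [g0 gD gM] := ideal_gen_ideal (set_mul A B).
apply/seteqP; split; last first.
  apply: sub_smallest2r; first exact: ideal_gen_ideal.
  by move=> _ [x [y [Ax By ->]]]; exists x, y; split=> //; apply: sub_gen_smallest.
apply: smallest_sub => [|_ [x [y [Ax By ->]]]]; first exact: ideal_gen_ideal.
have {Ax} Ax b : B b -> ideal_gen (set_mul A B) (x * b).
  move=> Bb; apply: (Ax [set x | ideal_gen (set_mul A B) (x * b)]).
  split=> [|a Aa]; last by apply: sub_gen_smallest; exists a, b.
  split=> /= [|u v|a u]; first by rewrite mul0r.
    by rewrite mulrDl; apply: gD.
  by rewrite -mulrA; apply: gM.
apply: (By [set y | ideal_gen (set_mul A B) (x * y)]); split=> //.
split=> /= [|u v|a u]; first by rewrite mulr0.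
  by rewrite mulrDr; apply: gD.
by rewrite mulrCA; apply: gM.
Qed.

Lemma set_mulC : commutative (@set_mul R).
Proof.
move=> A B; apply/seteqP.
by split=> _ [x [y [? ? ->]]]; exists y, x; split=> //; rewrite mulrC.
Qed.

Lemma set_mulA : associative (@set_mul R).
Proof.
move=> A B C; apply/seteqP; split=> u.
  move=> [x [t [Ax [y [z [By Cz et]]] ->]]]; rewrite et.
  by exists (x * y), z; rewrite mulrA; split=> //; exists x, y.
move=> [t [z [[x [y [Ax By et]]] Cz ->]]]; rewrite et.
by exists x, (y * z); rewrite mulrA; split=> //; exists y, z.
Qed.

Lemma ideal_gen_set0 : ideal_gen set0 = [set 0 : R].
Proof.
apply/seteqP; split=> [|_ -> I [[]]//]; apply: smallest_sub => //.
by split=> //= [x y -> ->|a x ->]; rewrite ?addr0 ?mulr0.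
Qed.

Fact cgideal_zero_subproof :
  exists2 A : set R, countable A & [set 0] = ideal_gen A.
Proof. by exists set0; [exact: countable0|rewrite ideal_gen_set0]. Qed.

Definition cgideal_zero : cgideal R := CGIdeal cgideal_zero_subproof.

Fact cgideal_mul_subproof (I J : cgideal R) :
  exists2 A : set R, countable A &
    ideal_mul (cgideal_set I) (cgideal_set J) = ideal_gen A.
Proof.
have [[A cA ->] [B cB ->]] :=
  (cgideal_countably_generated I, cgideal_countably_generated J).
rewrite ideal_genM.
exists (set_mul A B) => //.
have -> : set_mul A B = (fun p => p.1 * p.2) @` (A `*` B).
  apply/seteqP; split=> [_ [x [y [Ax By ->]]]|_ [[x y] [/= Ax By] <-]].
    by exists (x, y).
  by exists x, y.
exact: sub_countable (card_image_le _ _) (countableX cA cB).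
Qed.

Definition cgideal_mul (I J : cgideal R) : cgideal R :=
  CGIdeal (cgideal_mul_subproof I J).

Fact cgideal_mulA : associative cgideal_mul.
Proof.
move=> I J K; apply: cgideal_inj => /=.
have [[[A _ ->] [B _ ->]] [C _ ->]] := (cgideal_countably_generated I,
  cgideal_countably_generated J, cgideal_countably_generated K).
by rewrite !ideal_genM set_mulA.
Qed.

Fact cgideal_mulC : commutative cgideal_mul.
Proof. by move=> I J; apply: cgideal_inj; rewrite /= /ideal_mul set_mulC. Qed.

Fact cgideal_mul0 : left_zero cgideal_zero cgideal_mul.
Proof.
move=> I; apply: cgideal_inj => /=.
have [A _ ->] := cgideal_countably_generated I.
rewrite -ideal_gen_set0 ideal_genM; congr ideal_gen.
by apply/seteqP; split=> // u [x [y []]].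
Qed.

Fact cgideal_sqr_eq0 : reduced R ->
  forall I : cgideal R, cgideal_mul I I = cgideal_zero -> I = cgideal_zero.
Proof.
move=> hR I II0; apply: cgideal_inj; apply/seteqP; split=> [x Ix|_ ->] /=.
  apply: (hR x 2).
  have : cgideal_set (cgideal_mul I I) (x ^+ 2).
    by apply: sub_gen_smallest; exists x, x.
  by rewrite II0.
by have [A _ ->] := cgideal_countably_generated I; case: (ideal_gen_ideal A).
Qed.

Fact coef_ideal_subproof (f : {fps R}) :
  exists2 A : set R, countable A &
    ideal_gen (range (fps_coef f)) = ideal_gen A.
Proof.
exists (range (fps_coef f)) => //.
exact: sub_countable (card_image_le _ _) (countableP _).
Qed.

Definition coef_ideal (f : {fps R}) : cgideal R :=
  CGIdeal (coef_ideal_subproof f).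

End Ideals.

Definition cgideal_nfs (R : comPzRingType) (hR : reduced R) : nfSemigroup :=
  @NFSemigroup (cgideal R) (@cgideal_mul R) (cgideal_zero R)
    (@cgideal_mulA R) (@cgideal_mulC R) (@cgideal_mul0 R)
    (iterop_nilpotent_free (@cgideal_mulA R) (@cgideal_mulC R)
      (@cgideal_mul0 R) (cgideal_sqr_eq0 hR)).

(* Main.v *)
Require Import Defs.
From HB Require Import structures.
From mathcomp Require Import all_boot all_algebra.
From mathcomp Require Import classical_sets functions cardinality.

Import GRing.Theory.
Local Open Scope ring_scope.

(** Everything rests on Armendariz's observation ([fps_mul_eq0]): over a reduced
    ring, [f * g = 0] only when every coefficient of [f] annihilates every
    coefficient of [g].  To see it, induct on the total degree [n = i + j].
    Multiplying the degree-[n] equation [\sum_k f_k * g_(n - k) = 0] by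
    [f_i * g_(n - i)] kills every term other than the [i]-th: it acquires the
    factor [f_k * g_(n - i)] if [k < i] and [f_i * g_(n - k)] if [k > i], both
    of total degree below [n].  What is left is [(f_i * g_(n - i)) ^+ 2 = 0],
    and the ring is reduced.

    On the side of ideals, a product of generated ideals is generated by the
    products of generators, and a generated ideal vanishes exactly when its
    generators do.  So [c'(f) c'(g) = 0] is the same condition on pairs of
    coefficients ([coef_ideal_mul_eq0]).  Finally [c'] is onto because a
    nonempty countable generating set can be enumerated as the coefficient
    sequence of a power series ([coef_ideal_surj]). *)

(** The backward implication holds term by term in the Cauchy product; the
    forward one is the induction on total degree, where [n] bounds [i + j]. *)
Lemma fps_mul_eq0 (R : comPzRingType) (hR : reduced R) (f g : {fps R}) :
  f * g = 0 <-> forall i j, fps_coef f i * fps_coef g j = 0.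
Proof.
split=> [fg0 i j | h]; last first.
  by apply: fpsP => n /=; rewrite big1.
have [n] := ubnP (i + j); elim: n i j => // n IHn i j /[!ltnS] le_ij_n.
have IH k l : (k + l < i + j)%N -> fps_coef f k * fps_coef g l = 0.
  by move=> lt_kl; apply: IHn; apply: leq_trans le_ij_n.
apply: (hR _ 2%N).
have := congr1 (fun h => fps_coef f i * fps_coef g j * fps_coef h (i + j)) fg0.
have lt_i : (i < (i + j).+1)%N by rewrite ltnS leq_addr.
rewrite /= mulr0 (bigD1 (Ordinal lt_i)) //= addKn mulrDr -expr2.
rewrite big_distrr big1 /= ?addr0 // => k.
have le_k : (k <= i + j)%N by rewrite -ltnS ltn_ord.
(* Regrouping the four coefficients exposes a pair of smaller total degree. *)
rewrite -val_eqE /= neq_ltn => /orP[lt_ki | lt_ik].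
  rewrite mulrC [fps_coef f i * _]mulrC mulrACA IH ?mul0r //.
  by rewrite ltn_add2r.
rewrite [fps_coef f k * _]mulrC mulrACA IH ?mul0r //.
by rewrite ltn_add2l ltn_subLR // ltn_add2r.
Qed.

Lemma ideal_gen_eq0 (R : comPzRingType) (A : set R) :
  ideal_gen A = [set 0]%classic <-> forall x, A x -> x = 0.
Proof.
split=> [A0 x Ax | A0].
  have : ideal_gen A x by apply: sub_gen_smallest.
  by rewrite A0.
have [A_0 _ _] := ideal_gen_ideal A.
apply/seteqP; split=> [|_ ->] //; rewrite -ideal_gen_set0.
apply: smallest_sub; first exact: ideal_gen_ideal.
by move=> x /A0 ->; rewrite ideal_gen_set0.
Qed.

Lemma coef_ideal_eq0 (R : comPzRingType) (f : {fps R}) :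
  coef_ideal f = cgideal_zero R <-> f = 0.
Proof.
split=> [/(congr1 (@cgideal_set R)) /= /ideal_gen_eq0 f0 | ->].
  by apply: fpsP => n; apply: f0; exists n.
by apply/cgideal_inj/ideal_gen_eq0 => _ [n _ <-].
Qed.

Lemma coef_ideal_mul_eq0 (R : comPzRingType) (f g : {fps R}) :
  cgideal_mul (coef_ideal f) (coef_ideal g) = cgideal_zero R <->
  forall i j, fps_coef f i * fps_coef g j = 0.
Proof.
split=> [/(congr1 (@cgideal_set R)) /= | h].
  rewrite ideal_genM => /ideal_gen_eq0 fg0 i j; apply: fg0.
  by exists (fps_coef f i), (fps_coef g j); split=> //.
apply: cgideal_inj; rewrite /= ideal_genM; apply/ideal_gen_eq0.
by move=> _ [_ [_ [[i _ <-] [j _ <-] ->]]].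
Qed.

(** The empty generating set cannot be enumerated by coefficients; the ideal it
    generates is zero, which is the coefficient ideal of the zero series. *)
Lemma coef_ideal_surj (R : comPzRingType) (I : cgideal R) :
  exists f : {fps R}, coef_ideal f = I.
Proof.
have [A cA IA] := cgideal_countably_generated I.
have [A0 | [u]] := pfcard_geP cA.
  exists 0; apply: cgideal_inj; rewrite IA A0 ideal_gen_set0.
  by rewrite (coef_ideal_eq0 R 0).2.
exists (FPS u); apply: cgideal_inj; rewrite IA /=; congr ideal_gen.
by rewrite image_eq.
Qed.

Theorem lemma4p1 (R : comPzRingType) (hR : reduced R) :
  (forall f g : {fps R}, f * g = 0 ->
     cgideal_mul (coef_ideal f) (coef_ideal g) = cgideal_zero R) /\
  @Armendariz_map (fps_nfs hR) (cgideal_nfs hR) (@coef_ideal R).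
Proof.
have mul0 (f g : {fps R}) : f * g = 0 <->
    cgideal_mul (coef_ideal f) (coef_ideal g) = cgideal_zero R.
  by split=> [/(fps_mul_eq0 _ hR) /coef_ideal_mul_eq0
             | /coef_ideal_mul_eq0 /(fps_mul_eq0 _ hR)].
split=> [f g /mul0 // | ]; split=> [I | f | f g].
- exact: coef_ideal_surj.
- by split=> /coef_ideal_eq0.
- exact: mul0.
Qed.
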